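(* Let $R$ be a commutative ring with identity and $M$ a finitely generated torsion-free multiplication $R$-module. For a submodule $N$ of $M$, the following statements are equivalent. (1) $N$ is a semi $n$-submodule of $M$. (2) $(N:_{R}M)$ is a semi $n$-ideal of $R$. (3) $N=IM$ for some semi $n$-ideal $I$ of $R$.
   Context: Modules are unital. $\sqrt{0}$ is the nilradical of $R$; $Ann_R(m)=\{r\in R: rm=0\}$; $(N:_RM)=\{r\in R: rM\subseteq N\}$. $M$ is torsion-free if no nonzero $m\in M$ is annihilated by a nonzero element of $R$. $M$ is a multiplication module if every submodule of $M$ has the form $IM$ for some ideal $I$ of $R$. A proper submodule $N$ of $M$ is a semi $n$-submodule if whenever $r\in R$, $m\in M$ with $r^{2}m\in N$, $r\notin\sqrt{0}$ and $Ann_R(m)=0$, then $rm\in N$. A proper ideal $I$ of $R$ is a semi $n$-ideal if whenever $a\in R$ with $a^2\in I$ and $a\notin\sqrt{0}$, then $a\in I$.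
   Formalization: The module M is additionally assumed nonzero; for M = 0 over a nonzero ring, (3) holds with I the nilradical while (1) and (2) fail because N = M is not proper. *)

(* Defs.v *)
From HB Require Import structures.
From mathcomp Require Import all_boot all_order all_algebra.
From mathcomp Require Import boolp classical_sets.

Set Implicit Arguments.
Unset Strict Implicit.
Unset Printing Implicit Defensive.

Import GRing.Theory.
Local Open Scope classical_set_scope.
Local Open Scope ring_scope.

Section Ideals.
Variable R : comPzRingType.

(* Ideals are the submodules of the regular module; the unit ideal is one. *)
Definition is_ideal (I : set R) : Prop :=
  GRing.submod_closed (mem (I : set R^o)).

Definition nilradical : set R := [set r | exists n : nat, r ^+ n = 0].

Definition semi_n_ideal (I : set R) : Prop :=
  [/\ is_ideal I, I <> setT &
      forall a : R, I (a ^+ 2) -> ~ nilradical a -> I a].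

End Ideals.

Section Modules.
Variables (R : comPzRingType) (M : lmodType R).

Definition is_submodule (N : set M) : Prop := GRing.submod_closed (mem N).

Definition annihilator (m : M) : set R := [set r | r *: m = 0].

(* (N :_R M) *)
Definition residual (N : set M) : set R := [set r | forall m : M, N (r *: m)].

(* I M, the set of finite sums of products. *)
Definition ideal_smul (I : set R) : set M :=
  [set m | exists (n : nat) (a : 'I_n -> R) (x : 'I_n -> M),
     (forall i, I (a i)) /\ m = \sum_(i < n) a i *: x i].

Definition semi_n_submodule (N : set M) : Prop :=
  [/\ is_submodule N, N <> setT &
      forall (r : R) (m : M), N (r ^+ 2 *: m) -> ~ nilradical r ->
        annihilator m = [set 0] -> N (r *: m)].

End Modules.

Definition finitely_generated (R : comPzRingType) (M : lmodType R) : Prop :=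
  exists (n : nat) (g : 'I_n -> M),
    forall m : M, exists c : 'I_n -> R, m = \sum_(i < n) c i *: g i.

Definition torsion_free (R : comPzRingType) (M : lmodType R) : Prop :=
  forall m : M, m <> 0 -> ~ exists2 r : R, r <> 0 & r *: m = 0.

Definition multiplication_module (R : comPzRingType) (M : lmodType R) : Prop :=
  forall K : set M, is_submodule K ->
    exists2 I : set R, is_ideal I & K = ideal_smul I.

(* Main.v *)
(* A nonzero torsion-free module forces R to be a domain. For finitely generated
   M, with generators g_i and R g_i = J_i M, Nakayama's lemma gives
   1 = \sum_i a_i with a_i in J_i, that is, a_i M is contained in R g_i; testing
   r M <= I M on each a_i g_i then yields the cancellation law (I M : M) = I.
   With cancellation, for R m = J M the hypothesis r^2 m \in I M becomes
   r^2 J <= I, so that (r j)^2 \in I for every j in J. *)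
Require Import Defs.
From HB Require Import structures.
From mathcomp Require Import all_boot all_order all_algebra.
From mathcomp Require Import boolp classical_sets.
From mathcomp Require Import ring.

Import GRing.Theory.
Local Open Scope classical_set_scope.
Local Open Scope ring_scope.

Section Submodules.
Variables (R : comPzRingType) (M : lmodType R).
Implicit Types (N : set M) (I J : set R) (r s : R).

Lemma is_submoduleP N : is_submodule N <->
  [/\ N 0, forall x y, N x -> N y -> N (x + y) & forall r x, N x -> N (r *: x)].
Proof.
have memE x : (x \in mem N) = (x \in N) by [].
split=> [[N0 NL]|[N0 ND NZ]].
  have N0' : N 0 by move: N0; rewrite memE inE.
  have NL' a u v : N u -> N v -> N (a *: u + v).
    by move=> Nu Nv; move: (NL a u v); rewrite !memE !inE; exact.
  split=> [//|x y Nx Ny|r x Nx]; first by rewrite -[x]scale1r; exact: NL'.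
  by rewrite -[r *: x]addr0; exact: NL'.
split=> [|a u v]; rewrite !memE !inE // => Nu Nv.
by apply: ND => //; exact: NZ.
Qed.

Lemma submodule_sum N n (F : 'I_n -> M) :
  is_submodule N -> (forall i, N (F i)) -> N (\sum_i F i).
Proof.
by move=> /is_submoduleP[N0 ND _] NF; elim/big_ind: _.
Qed.

Lemma is_idealP I : is_ideal I <->
  [/\ I 0, forall x y, I x -> I y -> I (x + y) & forall r x, I x -> I (r * x)].
Proof.
have memE x : (x \in mem I) = (x \in I) by [].
split=> [[I0 IL]|[I0 ID IM]].
  have I0' : I 0 by move: I0; rewrite memE inE.
  have IL' a u v : I u -> I v -> I (a * u + v).
    by move=> Iu Iv; move: (IL a u v); rewrite !memE !inE; exact.
  split=> [//|x y Ix Iy|r x Ix]; first by rewrite -[x]mul1r; exact: IL'.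
  by rewrite -[r * x]addr0; exact: IL'.
split=> [|a u v]; rewrite !memE !inE // => Iu Iv.
by apply: ID => //; exact: IM.
Qed.

Lemma ideal_sum I n (F : 'I_n -> R) :
  is_ideal I -> (forall i, I (F i)) -> I (\sum_i F i).
Proof. by move=> /is_idealP[I0 ID _] IF; elim/big_ind: _. Qed.

Lemma mem_ideal_smul I r (m : M) : I r -> ideal_smul (M := M) I (r *: m).
Proof.
by move=> Ir; exists 1%N, (fun=> r), (fun=> m); rewrite big_ord1.
Qed.

Lemma ideal_smul_sub I N : is_submodule N ->
  (forall r m, I r -> N (r *: m)) -> ideal_smul I `<=` N.
Proof.
by move=> sN IN _ [n [a [x [Ia ->]]]]; apply: submodule_sum => // i; exact: IN.
Qed.

Lemma ideal_smul_submodule I : is_ideal I ->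
  is_submodule (ideal_smul (M := M) I).
Proof.
move=> /is_idealP[I0 ID IM]; apply/is_submoduleP; split.
- by rewrite -(scaler0 _ 0); exact: mem_ideal_smul.
- move=> _ _ [n [a [x [Ia ->]]]] [p [b [y [Ib ->]]]].
  exists (n + p)%N, (fun i => match split i with inl j => a j | inr j => b j end),
    (fun i => match split i with inl j => x j | inr j => y j end).
  split=> [i|]; first by case: split.
  rewrite big_split_ord /=; congr (_ + _); apply: eq_bigr => i _.
    by rewrite (unsplitK (inl i)).
  by rewrite (unsplitK (inr i)).
- move=> r _ [n [a [x [Ia ->]]]].
  exists n, (fun i => r * a i), x; split=> [i|]; first exact: IM.
  by rewrite scaler_sumr; apply: eq_bigr => i _; rewrite scalerA.
Qed.

Lemma residual_ideal N : is_submodule N -> is_ideal (residual N).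
Proof.
move=> /is_submoduleP[N0 ND NZ]; apply/is_idealP; split.
- by move=> m; rewrite scale0r.
- by move=> x y Nx Ny m; rewrite scalerDl; exact: ND.
- by move=> r x Nx m; rewrite -scalerA; exact: NZ.
Qed.

Lemma line_submodule (m : M) : is_submodule [set x | exists r, x = r *: m].
Proof.
apply/is_submoduleP; split.
- by exists 0; rewrite scale0r.
- by move=> _ _ [a ->] [b ->]; exists (a + b); rewrite scalerDl.
- by move=> r _ [a ->]; exists (r * a); rewrite scalerA.
Qed.

(** The predicate [P] allows for partial families: Nakayama elimination needs the [I]-combinations
    of the generators still remaining. *)
Lemma ideal_combinations_submodule I n (P : pred 'I_n) (g : 'I_n -> M) :
  is_ideal I ->
  is_submodule [set x | exists2 c : 'I_n -> R, forall i, I (c i) &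
                                        x = \sum_(i | P i) c i *: g i].
Proof.
move=> /is_idealP[I0 ID IM]; apply/is_submoduleP; split.
- by exists (fun=> 0) => //; rewrite big1 // => i _; rewrite scale0r.
- move=> _ _ [a Ia ->] [b Ib ->]; exists (fun i => a i + b i).
    by move=> i; exact: ID.
  by rewrite -big_split; apply: eq_bigr => i _; rewrite scalerDl.
- move=> r _ [a Ia ->]; exists (fun i => r * a i); first by move=> i; exact: IM.
  by rewrite scaler_sumr; apply: eq_bigr => i _; rewrite scalerA.
Qed.

(* Generators are eliminated one at a time: (1 - a) M lies in the span of the
   g_i with k <= i, and solving the relation expressing (1 - a) g_k in
   J (1 - a) M for g_k eliminates g_k. *)
Lemma nakayama J : is_ideal J -> finitely_generated M ->
  ideal_smul (M := M) J = setT ->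
  exists2 a, J a & forall m : M, (1 - a) *: m = 0.
Proof.
move=> iJ [n [g gen]] JM; have [J0 JD Jmul] := (is_idealP J).1 iJ.
suff H k : (k <= n)%N -> exists2 a, J a & forall m : M,
    exists c : 'I_n -> R, (1 - a) *: m = \sum_(i < n | (k <= i)%N) c i *: g i.
  have [a Ja aM] := H n (leqnn n); exists a => // m.
  have [c ->] := aM m; rewrite big1 // => i.
  by rewrite leqNgt ltn_ord.
elim: k => [_|k IH lt_kn].
  exists 0 => // m; rewrite subr0 scale1r; exact: gen.
have [a Ja aM] := IH (ltnW lt_kn).
pose ik := Ordinal lt_kn.
(* Write [g ik] in [J M] as a sum of [b i *: x i] with [b i] in [J]; multiplying by [1 - a] turns
   each [x i] into a combination of the remaining generators, and the factor [b i] keeps the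
   coefficients in [J]. *)
have [c Jc gE] : exists2 c : 'I_n -> R, forall i, J (c i) &
    (1 - a) *: g ik = \sum_(i < n | (k <= i)%N) c i *: g i.
  have : ideal_smul J (g ik) by rewrite JM.
  move=> [p [b [x [Jb ->]]]]; rewrite scaler_sumr.
  have sub := ideal_combinations_submodule J n (fun i => (k <= i)%N) g iJ.
  apply: (submodule_sum _ _ _ sub) => i; have [d dE] := aM (x i).
  exists (fun j => b i * d j); first by move=> j; rewrite mulrC; exact: Jmul.
  rewrite scalerA mulrC -scalerA dE scaler_sumr.
  by apply: eq_bigr => j _; rewrite scalerA.
have split_k (d : 'I_n -> R) : \sum_(i < n | (k <= i)%N) d i *: g i =
    d ik *: g ik + \sum_(i < n | (k < i)%N) d i *: g i.
  rewrite (bigD1 ik) //=; congr (_ + _); apply: eq_bigl => i.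
  by rewrite ltn_neqAle andbC eq_sym.
(* Chosen so that one minus it is [(1 - a - c ik) * (1 - a)]; the factor [1 - a - c ik] sends [g ik]
   into the span of the later generators. *)
exists (a + c ik + (1 - a - c ik) * a).
  by apply: (JD); [exact: JD | exact: Jmul].
move=> m; have [d dE] := aM m.
exists (fun i => d ik * c i + (1 - a - c ik) * d i).
have -> : 1 - (a + c ik + (1 - a - c ik) * a) = (1 - a - c ik) * (1 - a) by ring.
rewrite -scalerA dE split_k scalerDr scalerA mulrC -scalerA.
rewrite scalerBl gE split_k [_ + _ - _]addrAC subrr add0r !scaler_sumr -big_split.
by apply: eq_bigr => i _; rewrite !scalerA scalerDl.
Qed.

Lemma torsion_free_eq0 r (m : M) : torsion_free M ->
  m <> 0 -> r *: m = 0 -> r = 0.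
Proof.
by move=> tf m0 rm; apply: contrapT => r0; apply: (tf m m0); exists r.
Qed.

(** For nonzero [m], the vector [s *: m] is again nonzero, and [r] kills it. *)
Lemma torsion_free_mulf_eq0 r s : torsion_free M -> (exists m : M, m <> 0) ->
  r * s = 0 -> s <> 0 -> r = 0.
Proof.
move=> tf [m m0] rs s0; apply: (@torsion_free_eq0 _ (s *: m)) => //.
  by move=> sm; apply: s0; exact: torsion_free_eq0 sm.
by rewrite scalerA rs scale0r.
Qed.

Lemma torsion_free_expf_eq0 r n : torsion_free M -> (exists m : M, m <> 0) ->
  r ^+ n = 0 -> r = 0.
Proof.
move=> tf M0 rn; apply: contrapT => r0; elim: n rn => [|n IH].
  rewrite expr0 => one0; apply: r0.
  by rewrite -[r]mul1r one0 mul0r.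
by rewrite exprSr => /torsion_free_mulf_eq0 rn; apply/IH/rn.
Qed.

Lemma multiplication_cancellation I r : (exists m : M, m <> 0) ->
  finitely_generated M -> torsion_free M -> multiplication_module M ->
  is_ideal I -> residual (ideal_smul (M := M) I) r -> I r.
Proof.
move=> [m0 m0N0] fg tf mul iI rI; have [n [g gen]] := fg.
have [I0 ID Imul] := (is_idealP I).1 iI.
pose J i := residual [set x | exists s, x = s *: g i].
have iJ i : is_ideal (J i) by apply: residual_ideal; exact: line_submodule.
(* [S] is the sum of the ideals [J i]; the aim is [S M = M], so that Nakayama puts 1 in [S]. *)
pose S := [set s | exists2 a : 'I_n -> R, forall i, J i (a i) & s = \sum_i a i].
have iS : is_ideal S.
  apply/is_idealP; split.
  - exists (fun=> 0); last by rewrite big1.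
    by move=> i; have [] := (is_idealP _).1 (iJ i).
  - move=> _ _ [a Ja ->] [b Jb ->]; exists (fun i => a i + b i).
      by move=> i; have [_ JD _] := (is_idealP _).1 (iJ i); exact: JD.
    by rewrite big_split.
  - move=> s _ [a Ja ->]; exists (fun i => s * a i); last by rewrite mulr_sumr.
    by move=> i; have [_ _ Jmul] := (is_idealP _).1 (iJ i); exact: Jmul.
have JS i a : J i a -> S a.
  move=> Ja; exists (fun j => if j == i then a else 0).
    move=> j; case: eqP => [->//|_].
    by have [] := (is_idealP _).1 (iJ j).
  by rewrite -big_mkcond big_pred1_eq.
(* If [R g_i = K M], then [K] lies in [J i], hence in [S], and [g i] belongs to [K M]. *)
have gS i : ideal_smul S (g i).
  have [K _ KE] := mul _ (line_submodule (g i)).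
  have : ideal_smul K (g i) by rewrite -KE; exists 1; rewrite scale1r.
  apply: ideal_smul_sub; first exact: ideal_smul_submodule.
  move=> s m Ks; apply: mem_ideal_smul; apply: (JS i) => x /=.
  by have := mem_ideal_smul K s x Ks; rewrite -KE.
have sSM := ideal_smul_submodule S iS.
have [_ _ SZ] := (is_submoduleP _).1 sSM.
have SM : ideal_smul (M := M) S = setT.
  apply/seteqP; split=> // m _; have [c ->] := gen m.
  by apply: submodule_sum => // i; exact: SZ.
have [s [a Ja sE] sM] := nakayama S iS fg SM.
(* By Nakayama [1 - s] kills the nonzero vector [m0], so it vanishes. *)
have s1 : 1 = \sum_i a i.
  by apply/eqP; rewrite -sE -subr_eq0; apply/eqP/(torsion_free_eq0 _ m0).
rewrite -[r]mul1r s1 mulr_suml; apply: ideal_sum => // i.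
have [gi0|gi0] := pselect (g i = 0).
  suff -> : a i = 0 by rewrite mul0r.
  apply: (torsion_free_eq0 _ m0) => //.
  by have [t ->] := Ja i m0; rewrite gi0 scaler0.
(* The vectors that [a i] sends into [I g_i] form a submodule. It contains [b *: m] for [b] in [I],
   because [a i *: m] is a multiple of [g i]; so it contains [I M], and in particular [r *: g i].
   Cancelling [g i] then puts [a i * r] in [I]. *)
suff /(ideal_smul_sub I) :
    is_submodule [set x | exists2 t, I t & a i *: x = t *: g i].
  move=> sub; have /sub : forall b m, I b ->
      exists2 t, I t & a i *: (b *: m) = t *: g i.
    move=> b m Ib; have [t tE] := Ja i m; exists (b * t).
      by rewrite mulrC; exact: Imul.
    by rewrite -[RHS]scalerA -tE !scalerA (mulrC b).
  move=> /(_ _ (rI (g i)))[t It tE]; suff -> : a i * r = t by [].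
  apply/eqP; rewrite -subr_eq0; apply/eqP; apply: (torsion_free_eq0 _ _ tf gi0).
  by rewrite scalerBl -scalerA tE subrr.
apply/is_submoduleP; split.
- by exists 0; rewrite ?scaler0 ?scale0r.
- move=> x y [t It tE] [u Iu uE]; exists (t + u); first exact: ID.
  by rewrite scalerDr scalerDl tE uE.
- move=> b x [t It tE]; exists (b * t); first exact: Imul.
  by rewrite -[RHS]scalerA -tE !scalerA (mulrC b).
Qed.

(** If [N = K M], then [K] lies in the residual, so [N = K M] is squeezed between [(N : M) M] and
    [N]. *)
Lemma residual_smul N : multiplication_module M -> is_submodule N ->
  N = ideal_smul (residual N).
Proof.
move=> mul sN; apply/seteqP; split; last first.
  by apply: ideal_smul_sub => // r m; exact.
have [K _ NE] := mul N sN.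
rewrite {1}NE; apply: ideal_smul_sub.
  by apply: ideal_smul_submodule; exact: residual_ideal.
move=> r m Kr; apply: mem_ideal_smul => x.
by rewrite NE; exact: mem_ideal_smul.
Qed.

End Submodules.

(** [hM0] excludes the zero module: over a nonzero ring it has no proper submodule, so the first two
    statements fail, while the third holds with the nilradical as [I]. *)
Theorem corollary3 (R : comPzRingType) (M : lmodType R)
  (hM0 : exists m : M, m <> 0)
  (hfg : finitely_generated M) (htf : torsion_free M)
  (hmul : multiplication_module M)
  (N : set M) (hN : is_submodule N) :
  [<-> semi_n_submodule N;
       semi_n_ideal (residual N);
       exists2 I : set R, semi_n_ideal I & N = ideal_smul I].
Proof.
tfae.
- move=> [_ NT N2]; split; first exact: residual_ideal.
    move=> resT; apply: NT; apply/seteqP; split=> // m _.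
    have : residual N 1 by rewrite resT.
    by move=> /(_ m); rewrite scale1r.
  (* Torsion-freeness makes the annihilator of every nonzero [m] zero, so the semi n-condition
     applies to it; [m = 0] is treated apart. *)
  move=> a Na a_nil m; have [->|m0] := pselect (m = 0).
    by have [N0 _ _] := (is_submoduleP _ _ N).1 hN; rewrite scaler0.
  apply: N2 => //; apply/seteqP; split=> [r /=|_ ->]; last exact: scale0r.
  exact: torsion_free_eq0.
- by move=> hres; exists (residual N) => //; exact: residual_smul.
- move=> [I [iI IT I2] NE]; split=> //.
    move=> NT; apply: IT; apply/seteqP; split=> // r _.
    apply: (multiplication_cancellation R M) => // m.
    by rewrite -NE NT.
  move=> r m Nr r_nil _.
  have [J _ JE] := hmul _ (line_submodule R M m).
  have [N0 _ NZ] := (is_submoduleP _ _ N).1 hN.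
  have [I0 _ Imul] := (is_idealP _ I).1 iI.
  (* Since [m] lies in [J M], the inclusion of [r J] in [I] gives [r *: m] in [I M = N]. *)
  have rJ j : J j -> I (r * j).
    move=> Jj; have [->|j0] := pselect (j = 0); first by rewrite mulr0.
    have rj2 : I ((r * j) ^+ 2).
      rewrite exprMn mulrC expr2 -mulrA; apply: Imul; rewrite mulrC.
      apply: (multiplication_cancellation R M) => // x; rewrite -NE.
      have [t tE] : [set y | exists t, y = t *: m] (j *: x).
        by rewrite JE; exact: mem_ideal_smul.
      by rewrite -scalerA tE scalerA mulrC -scalerA; exact: NZ.
    (* A nilpotent [r * j] would be zero, and [j] is nonzero, so [r] would be zero, against
       [r_nil]. *)
    apply: I2 => // -[n /(torsion_free_expf_eq0 R M _ _ htf hM0) rj0].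
    apply: r_nil; exists 1%N; rewrite expr1.
    exact: (torsion_free_mulf_eq0 R M _ _ htf hM0 rj0).
  have : ideal_smul J m by rewrite -JE; exists 1; rewrite scale1r.
  move=> [n [a [x [Ja ->]]]]; rewrite scaler_sumr.
  apply: submodule_sum => // i; rewrite scalerA NE.
  by apply: mem_ideal_smul; exact: rJ.
Qed.
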